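(* Let $\mathbb F$ be a field, let $N\in\mathbb N$, and let $V$ be a vector space over $\mathbb F$ of dimension $N+1$. Suppose we are given three totally opposite flags on $V$, denoted $\{U_i\}_{i=0}^N$, $\{U'_i\}_{i=0}^N$, $\{U''_i\}_{i=0}^N$. For each location $\lambda=(r,s,t)$ in $\Delta_N$ define $$B_\lambda=U_{N-r}\cap U'_{N-s}\cap U''_{N-t}.$$ Then the map $B:\Delta_N\to\mathcal P_1(V)$, $\lambda\mapsto B_\lambda$ is a Billiard Array on $V$.
   Context: $\mathbb N=\{0,1,2,\ldots\}$. $\Delta_N=\{(r,s,t): r,s,t\in\mathbb N,\ r+s+t=N\}$, whose elements are called locations. A line in $\Delta_N$ is a set consisting of all locations whose $\eta$-coordinate equals a fixed number $n$, for some $\eta\in\{1,2,3\}$ and some $0\le n\le N$. For $N\ge1$, a black 3-clique in $\Delta_N$ is a set $\{(r+1,s,t),(r,s+1,t),(r,s,t+1)\}$ with $(r,s,t)\in\Delta_{N-1}$ (there are none for $N=0$). Let $\mathcal P_1(V)$ be the set of one-dimensional subspaces of $V$. A Billiard Array on $V$ (where $\dim V=N+1$) is a function $B:\Delta_N\to\mathcal P_1(V)$, $\lambda\mapsto B_\lambda$, such that (i) for each line $L$ in $\Delta_N$ the sum $\sum_{\lambda\in L}B_\lambda$ is direct; (ii) for each black 3-clique $C$ in $\Delta_N$ the sum $\sum_{\lambda\in C}B_\lambda$ is not direct. A flag on $V$ is a sequence $\{U_i\}_{i=0}^N$ of subspaces of $V$ with $\dim U_i=i+1$ for $0\le i\le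 N$ and $U_{i-1}\subseteq U_i$ for $1\le i\le N$. Three flags $\{U_i\}_{i=0}^N,\{U'_i\}_{i=0}^N,\{U''_i\}_{i=0}^N$ on $V$ are called totally opposite whenever $U_{N-r}\cap U'_{N-s}\cap U''_{N-t}=0$ for all integers $r,s,t$ with $0\le r,s,t\le N$ and $r+s+t>N$. *)

(* Defs.v *)
From mathcomp Require Import all_boot all_order all_algebra.

Set Implicit Arguments.
Unset Strict Implicit.
Unset Printing Implicit Defensive.

Definition location (N : nat) :=
  {x : 'I_N.+1 * 'I_N.+1 * 'I_N.+1 | x.1.1 + x.1.2 + x.2 == N}.

Definition loc1 (N : nat) (l : location N) : nat := (val l).1.1.
Definition loc2 (N : nat) (l : location N) : nat := (val l).1.2.
Definition loc3 (N : nat) (l : location N) : nat := (val l).2.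

(* The coordinate index is 0-based. *)
Definition loc_coord (N : nat) (eta : 'I_3) (l : location N) : nat :=
  tnth [tuple loc1 l; loc2 l; loc3 l] eta.

Definition is_line (N : nat) (L : {set location N}) : Prop :=
  exists (eta : 'I_3) (n : nat),
    n <= N /\ L = [set l | loc_coord eta l == n].

Definition loc_triple (N : nat) (l : location N) : nat * nat * nat :=
  (loc1 l, loc2 l, loc3 l).

(* (r, s, t) is a location of Delta_(N-1) with N >= 1, written without
   truncated subtraction so that there is no black 3-clique when N = 0. *)
Definition is_black_3_clique (N : nat) (C : {set location N}) : Prop :=
  exists r s t : nat,
    (r + s + t).+1 = N /\
    C = [set l | loc_triple l \in [:: (r.+1, s, t); (r, s.+1, t); (r, s, t.+1)]].

Record is_billiard_array (F : fieldType) (V : vectType F) (N : nat)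
    (B : location N -> {vspace V}) : Prop := IsBilliardArray {
  billiard_dim1 : forall l : location N, \dim (B l) = 1;
  billiard_line : forall L : {set location N}, is_line L ->
    directv (\sum_(l in L) B l)%VS;
  billiard_clique : forall C : {set location N}, is_black_3_clique C ->
    ~ directv (\sum_(l in C) B l)%VS
}.

Record is_flag (F : fieldType) (V : vectType F) (N : nat)
    (U : 'I_N.+1 -> {vspace V}) : Prop := IsFlag {
  flag_dim : forall i : 'I_N.+1, \dim (U i) = i.+1;
  flag_sub : forall i j : 'I_N.+1, i.+1 = j -> (U i <= U j)%VS
}.

(* sub_ord r : 'I_N.+1 is the index N - r. *)
Definition totally_opposite (F : fieldType) (V : vectType F) (N : nat)
    (U U' U'' : 'I_N.+1 -> {vspace V}) : Prop :=
  forall r s t : nat, r <= N -> s <= N -> t <= N -> N < r + s + t ->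
    (U (sub_ord r) :&: U' (sub_ord s) :&: U'' (sub_ord t))%VS = 0%VS.

(* Main.v *)
Require Import Defs.
From mathcomp Require Import all_boot all_order all_algebra.
From mathcomp Require Import zify.

Set Implicit Arguments.
Unset Strict Implicit.
Unset Printing Implicit Defensive.

(** Write a flag by codimension: [A r] is the term of codimension [r], continued
    by [0] beyond codimension [N]. Total opposition then says that the triple
    intersection [W r s t] of [A r], [A' s], [A'' t] vanishes as soon as
    [r + s + t > N].

    Raising [r] by one lowers the dimension of [W r s t] by at most one, so
    vanishing past level [N] forces [\dim (W r s t) <= N + 1 - (r + s + t)]
    ([opposite_dim_le]); the usual bound on the codimension of an intersection
    gives the reverse inequality. At level [N] this makes every [B_lambda]
    one-dimensional.

    Along a line of the triangle one coordinate is constant, and a second one,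
    say [s], tells its locations apart. There [B_lambda] lies in [A' s] but
    meets [A' (s + 1)] trivially, because the intersection is at level [N + 1];
    vectors leaving a decreasing filtration at different steps are independent
    ([directv_filtration]). A black 3-clique, finally, is made of three
    one-dimensional spaces lying in one [W r s t] of level [N - 1], hence
    of dimension at most 2, so their sum cannot be direct. *)

(** * Dimensions and direct sums *)

Section VectorSpaces.

Variables (F : fieldType) (V : vectType F).
Implicit Types X Y W : {vspace V}.

(** The quotient of [X :&: W] by [Y :&: W] embeds in that of [X] by [Y]. *)
Lemma dimv_cap_sub X Y W :
  (Y <= X)%VS -> \dim (X :&: W) + \dim Y <= \dim X + \dim (Y :&: W).
Proof.
move=> sYX.
have <- : (X :&: W :&: Y)%VS = (Y :&: W)%VS.
  by rewrite capvC capvA (capv_idPl sYX).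
rewrite -dimv_sum_cap leq_add2r; apply: dimvS.
by rewrite subv_add capvSl.
Qed.

Lemma dimv_cap_ge X Y : \dim X + \dim Y <= \dim {:V} + \dim (X :&: Y).
Proof. by rewrite -dimv_sum_cap leq_add2r dimvS ?subvf. Qed.

(** In a vanishing sum of vectors [u i] of [B i], the nonzero term of least
    [f i] would lie in [A (f i).+1], as all the other terms do, since they
    have strictly larger values of [f]. *)
Lemma directv_filtration (I : finType) (P : pred I) (B : I -> {vspace V})
    (A : nat -> {vspace V}) (f : I -> nat) :
    {homo A : m n / m <= n >-> (n <= m)%VS} -> {in P &, injective f} ->
    (forall i, P i -> B i <= A (f i))%VS ->
    (forall i, P i -> B i :&: A (f i).+1 = 0)%VS ->
  directv (\sum_(i | P i) B i)%VS.
Proof.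
move=> A_anti f_inj B_sub B_cap; apply/directv_sum_independent => u uB u0.
suff main n i : P i -> f i = n -> u i = 0%R by move=> i Pi; exact: main Pi erefl.
elim/ltn_ind: n i => n IHn i Pi fi.
apply/eqP; rewrite -memv0 -(B_cap i Pi) memv_cap uB //=.
move: u0; rewrite (bigD1 i) //= => /eqP; rewrite GRing.addr_eq0 => /eqP ->.
rewrite memvN; apply: memv_suml => j /andP[Pj ji].
case: (ltngtP (f j) (f i)) => [lt_ji|lt_ij|eq_ji].
- by rewrite (IHn (f j)) ?mem0v -?fi.
- exact: subvP (A_anti _ _ lt_ij) _ (subvP (B_sub j Pj) _ (uB j Pj)).
- by rewrite (f_inj j i Pj Pi eq_ji) eqxx in ji.
Qed.

End VectorSpaces.

(** * Flags indexed by codimension *)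

Section Codimension.

Variables (F : fieldType) (V : vectType F) (N : nat).
Implicit Types U : 'I_N.+1 -> {vspace V}.

Definition codim_flag U (r : nat) : {vspace V} :=
  if r <= N then U (sub_ord r) else 0%VS.

Lemma codim_flagE U r : r <= N -> codim_flag U r = U (sub_ord r).
Proof. by rewrite /codim_flag => ->. Qed.

Lemma dim_codim_flag U r : is_flag U -> \dim (codim_flag U r) = N.+1 - r.
Proof.
move=> flagU; rewrite /codim_flag; case: leqP => rN; last first.
  by rewrite dimv0; apply/esym/eqP; rewrite subn_eq0.
by rewrite (flag_dim flagU) /= subSn.
Qed.

Lemma codim_flagS U r : is_flag U -> (codim_flag U r.+1 <= codim_flag U r)%VS.
Proof.
move=> flagU; rewrite /codim_flag; case: ltnP => rN; last exact: sub0v.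
by rewrite ltnW //; apply: (flag_sub flagU); rewrite /= subnSK.
Qed.

Lemma codim_flag_anti U : is_flag U ->
  {homo codim_flag U : m n / m <= n >-> (n <= m)%VS}.
Proof.
move=> flagU m n /subnK <-; elim: (n - m) => [|k IHk]; first exact: subvv.
exact: subv_trans (codim_flagS _ flagU) IHk.
Qed.

Variables U U' U'' : 'I_N.+1 -> {vspace V}.

Definition triple_cap (r s t : nat) : {vspace V} :=
  (codim_flag U r :&: codim_flag U' s :&: codim_flag U'' t)%VS.

Lemma triple_cap_sub1 r s t : (triple_cap r s t <= codim_flag U r)%VS.
Proof. by rewrite /triple_cap -capvA capvSl. Qed.

Lemma triple_cap_sub2 r s t : (triple_cap r s t <= codim_flag U' s)%VS.
Proof. exact: subv_trans (capvSl _ _) (capvSr _ _). Qed.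

Lemma triple_cap_sub3 r s t : (triple_cap r s t <= codim_flag U'' t)%VS.
Proof. exact: capvSr. Qed.

Lemma triple_cap0 r s t :
  totally_opposite U U' U'' -> N < r + s + t -> triple_cap r s t = 0%VS.
Proof.
move=> oppU lvl; rewrite /triple_cap /codim_flag.
by do 3![case: leqP => ?]; rewrite ?(cap0v, capv0) //; apply: oppU.
Qed.

Hypotheses (flagU : is_flag U) (flagU' : is_flag U') (flagU'' : is_flag U'').

Lemma triple_capS r s t r' s' t' : r <= r' -> s <= s' -> t <= t' ->
  (triple_cap r' s' t' <= triple_cap r s t)%VS.
Proof. by move=> *; rewrite !capvS ?codim_flag_anti. Qed.

Lemma triple_cap_next1 r s t :
  (triple_cap r s t :&: codim_flag U r.+1)%VS = triple_cap r.+1 s t.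
Proof.
by rewrite /triple_cap capvC !capvA (capv_idPl (codim_flagS _ flagU)).
Qed.

Lemma triple_cap_next2 r s t :
  (triple_cap r s t :&: codim_flag U' s.+1)%VS = triple_cap r s.+1 t.
Proof.
rewrite /triple_cap -!capvA (capvC (codim_flag U'' t)).
by rewrite (capvA (codim_flag U' s)) (capv_idPr (codim_flagS _ flagU')).
Qed.

Lemma triple_cap_next3 r s t :
  (triple_cap r s t :&: codim_flag U'' t.+1)%VS = triple_cap r s t.+1.
Proof. by rewrite /triple_cap -!capvA (capv_idPr (codim_flagS _ flagU'')). Qed.

(** Each unit step in [r] costs at most one dimension, and [k] steps reach a
    level where nothing is left. *)
Lemma opposite_dim_le k r s t :
  totally_opposite U U' U'' -> N < r + s + t + k -> \dim (triple_cap r s t) <= k.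
Proof.
move=> oppU; elim: k r => [|k IHk] r lvl.
  by rewrite triple_cap0 ?dimv0 // -[_ + t]addn0.
have /IHk dimS : N < r.+1 + s + t + k by lia.
have := dimv_cap_sub (codim_flag U' s :&: codim_flag U'' t) (codim_flagS r flagU).
by move: dimS; rewrite /triple_cap !capvA !dim_codim_flag //; lia.
Qed.

Lemma triple_cap_dim_ge r s t : \dim {:V} = N.+1 ->
  N.+1 - (r + s + t) <= \dim (triple_cap r s t).
Proof.
move=> dimV; rewrite /triple_cap.
have := dimv_cap_ge (codim_flag U r) (codim_flag U' s).
have := dimv_cap_ge (codim_flag U r :&: codim_flag U' s) (codim_flag U'' t).
by rewrite !dim_codim_flag // dimV; lia.
Qed.

End Codimension.

(** * Locations *)

Section Locations.

Variable N : nat.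
Implicit Types l : location N.

Lemma loc_sum l : loc1 l + loc2 l + loc3 l = N.
Proof. exact: eqP (valP l). Qed.

Lemma loc_triple_inj : injective (@loc_triple N).
Proof.
move=> l m [e1 e2 e3]; apply: val_inj.
rewrite [val l]surjective_pairing [(val l).1]surjective_pairing.
rewrite [val m]surjective_pairing [(val m).1]surjective_pairing.
by congr (_, _, _); apply: val_inj.
Qed.

Lemma loc_exists r s t :
  r + s + t = N -> exists l : location N, loc_triple l = (r, s, t).
Proof.
move=> rstN.
have [rN sN tN] : [/\ r < N.+1, s < N.+1 & t < N.+1] by split; lia.
pose x : 'I_N.+1 * 'I_N.+1 * 'I_N.+1 := (Ordinal rN, Ordinal sN, Ordinal tN).
have xP : x.1.1 + x.1.2 + x.2 == N by apply/eqP.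
by exists (Sub x xP).
Qed.

Lemma card_triples (ts : seq (nat * nat * nat)) :
    uniq ts -> (forall r s t, (r, s, t) \in ts -> r + s + t = N) ->
  #|[set l : location N | loc_triple l \in ts]| = size ts.
Proof.
move=> ts_uniq tsN; rewrite cardsE cardE -(size_map (@loc_triple N)).
apply/perm_size/uniq_perm => //.
  by rewrite (map_inj_uniq loc_triple_inj) enum_uniq.
move=> [[r s] t]; apply/mapP/idP => [[l + ->]|rst_ts].
  by rewrite mem_enum.
have [l lE] := loc_exists (tsN _ _ _ rst_ts).
by exists l; rewrite // mem_enum unfold_in /= lE.
Qed.

End Locations.

(** * Billiard arrays *)

Theorem theorem12p7 (F : fieldType) (N : nat) (V : vectType F)
    (dimV : \dim {:V} = N.+1)
    (U U' U'' : 'I_N.+1 -> {vspace V})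
    (flagU : is_flag U) (flagU' : is_flag U') (flagU'' : is_flag U'')
    (oppU : totally_opposite U U' U'') :
  is_billiard_array (fun l : location N =>
    (U (sub_ord (loc1 l)) :&: U' (sub_ord (loc2 l)) :&: U'' (sub_ord (loc3 l)))%VS).
Proof.
set B := fun l => _.
pose W := triple_cap U U' U''.
have BE l : B l = W (loc1 l) (loc2 l) (loc3 l).
  by have lN := loc_sum l; rewrite /W /triple_cap !codim_flagE //; lia.
have B_dim l : \dim (B l) = 1.
  have lN := loc_sum l; apply/eqP; rewrite eqn_leq BE; apply/andP; split.
    by apply: opposite_dim_le => //; lia.
  apply: leq_trans (triple_cap_dim_ge flagU flagU' flagU'' _ _ _ dimV).
  by lia.
split=> // [L [eta [n [_ ->]]] | C [r [s [t [rstN ->]]]]].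
  (* [f] is a second coordinate: with the constant one it fixes the location. *)
  have line_dir (A : nat -> {vspace V}) (f : location N -> nat) :
      {homo A : i j / i <= j >-> (j <= i)%VS} ->
      (forall l m, loc_coord eta l = loc_coord eta m -> f l = f m ->
        loc_triple l = loc_triple m) ->
      (forall l, B l <= A (f l))%VS -> (forall l, B l :&: A (f l).+1 = 0)%VS ->
    directv (\sum_(l in [set l | loc_coord eta l == n]) B l)%VS.
    move=> A_anti fP B_sub B_cap; apply: (directv_filtration A_anti) => // l m.
    rewrite !inE => /eqP el /eqP em flm.
    by apply/loc_triple_inj/fP; rewrite ?el ?em.
  have triple_eq (l m : location N) :
      [|| (loc1 l == loc1 m) && (loc2 l == loc2 m),
          (loc2 l == loc2 m) && (loc3 l == loc3 m)
        | (loc3 l == loc3 m) && (loc1 l == loc1 m)] ->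
    loc_triple l = loc_triple m.
    have := loc_sum l; have := loc_sum m; rewrite /loc_triple => *.
    by congr (_, _, _); lia.
  have lt_sum (l : location N) : N < (loc1 l + loc2 l + loc3 l).+1 by rewrite loc_sum.
  (* [f] is the coordinate following [eta] cyclically; stepping it past [f l]
     raises the level to [N.+1]. *)
  case: eta line_dir => [[|[|[|?]]] ?] // line_dir.
  - apply: (line_dir _ (@loc2 N) (codim_flag_anti flagU')) => [l m|l|l].
    + move=> e1 e2; apply: triple_eq.
      by rewrite (e1 : loc1 l = loc1 m) e2 !eqxx.
    + by rewrite BE triple_cap_sub2.
    + by rewrite BE triple_cap_next2 // triple_cap0 // addnS addSn.
  - apply: (line_dir _ (@loc3 N) (codim_flag_anti flagU'')) => [l m|l|l].
    + move=> e1 e2; apply: triple_eq.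
      by rewrite (e1 : loc2 l = loc2 m) e2 !eqxx !orbT.
    + by rewrite BE triple_cap_sub3.
    + by rewrite BE triple_cap_next3 // triple_cap0 // addnS.
  - apply: (line_dir _ (@loc1 N) (codim_flag_anti flagU)) => [l m|l|l].
    + move=> e1 e2; apply: triple_eq.
      by rewrite (e1 : loc3 l = loc3 m) e2 !eqxx !orbT.
    + by rewrite BE triple_cap_sub1.
    + by rewrite BE triple_cap_next1 // triple_cap0 // !addSn.
have sum_sub : (\sum_(l in [set l | loc_triple l \in
    [:: (r.+1, s, t); (r, s.+1, t); (r, s, t.+1)]]) B l <= W r s t)%VS.
  apply/subv_sumP => l; rewrite !inE BE.
  by case/or3P=> /eqP[-> -> ->]; apply: triple_capS.
rewrite directvE /= (eq_bigr (fun=> 1)) // sum1_card card_triples /=; last 2 first.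
- by rewrite !inE !xpair_eqE; lia.
- by move=> a b c; rewrite !inE => /or3P[] /eqP[-> -> ->]; lia.
move/eqP=> dim3; have := dimvS sum_sub; rewrite dim3.
suff : \dim (W r s t) <= 2 by lia.
by apply: opposite_dim_le => //; lia.
Qed.
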